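(* Let $C$ be an MDS $[q+2,k,d]_q$ code, where $q=2^m$ and $m>1$. (i) If $C$ is an MDS $[2^m+2,3,2^m]_{2^m}$ code with odd $m$, then $C$ is not uniformly packed in the wide sense (and so, not completely regular). (ii) If $C$ is an MDS $[2^m+2,2^m-1,4]_{2^m}$ code, then $C$ is completely regular.
   Context: $\mathbb{F}_q$ is the finite field of order $q$. An $[n,k,d]_q$ code $C$ is a $k$-dimensional linear subspace of $\mathbb{F}_q^n$ with minimum Hamming distance $d$; it is assumed that $0<k<n$. $C$ is MDS if $d=n-k+1$. For $\mathbf{v}\in\mathbb{F}_q^n$, $d(\mathbf{v},C)=\min\{d(\mathbf{v},\mathbf{x}) : \mathbf{x}\in C\}$ (Hamming distance), and for $t\in\{0,\dots,n\}$, $B_{\mathbf{v},t}=|\{\mathbf{x}\in C : d(\mathbf{v},\mathbf{x})=t\}|$. The covering radius is $\rho=\max_{\mathbf{v}\in\mathbb{F}_q^n} d(\mathbf{v},C)$. $C$ is completely regular if $B_{\mathbf{v},t}$ depends only on $t$ and $d(\mathbf{v},C)$. $C$ is uniformly packed in the wide sense if there exist rational numbers $\beta_0,\dots,\beta_\rho$ such that $\sum_{i=0}^{\rho}\beta_i B_{\mathbf{x},i}=1$ for every $\mathbf{x}\in\mathbb{F}_q^n$. *)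

(* Defs.v *)
From mathcomp Require Import all_boot all_order all_algebra.

Set Implicit Arguments.
Unset Strict Implicit.
Unset Printing Implicit Defensive.

Import GRing.Theory.

Definition hdist (F : finFieldType) (n : nat) (x y : 'rV[F]_n) : nat :=
  #|[set i : 'I_n | x ord0 i != y ord0 i]|.

(* Distances never exceed n, so the neutral element n of the iterated minimum
   matters only for the zero code, which [linear_code] excludes. *)
Definition min_dist (F : finFieldType) (n : nat) (C : {vspace 'rV[F]_n}) : nat :=
  \big[minn/n]_(p : 'rV[F]_n * 'rV[F]_n |
      [&& p.1 \in C, p.2 \in C & p.1 != p.2]) hdist p.1 p.2.

(* C is an [n, k, d] code over F. *)
Definition linear_code (F : finFieldType) (n : nat) (C : {vspace 'rV[F]_n})
    (k d : nat) : Prop :=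
  [/\ 0 < k < n, \dim C = k & min_dist C = d].

(* The subtraction is not truncated, since \dim C <= n. *)
Definition mds (F : finFieldType) (n : nat) (C : {vspace 'rV[F]_n}) : Prop :=
  min_dist C = n - \dim C + 1.

(* The minimum over C is attained: the zero word, which lies in C, is the seed
   of the arg min. *)
Definition dist_code (F : finFieldType) (n : nat) (v : 'rV[F]_n)
    (C : {vspace 'rV[F]_n}) : nat :=
  hdist v [arg min_(x < (0%R : 'rV[F]_n) | x \in C) hdist v x].

Definition nb_at_dist (F : finFieldType) (n : nat) (C : {vspace 'rV[F]_n})
    (v : 'rV[F]_n) (t : nat) : nat :=
  #|[set x : 'rV[F]_n | (x \in C) && (hdist v x == t)]|.

Definition covering_radius (F : finFieldType) (n : nat)
    (C : {vspace 'rV[F]_n}) : nat :=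
  \max_(v : 'rV[F]_n) dist_code v C.

Definition completely_regular (F : finFieldType) (n : nat)
    (C : {vspace 'rV[F]_n}) : Prop :=
  forall (v w : 'rV[F]_n) (t : nat), t <= n ->
    dist_code v C = dist_code w C -> nb_at_dist C v t = nb_at_dist C w t.

Definition uniformly_packed (F : finFieldType) (n : nat)
    (C : {vspace 'rV[F]_n}) : Prop :=
  exists beta : 'I_(covering_radius C).+1 -> rat,
    forall x : 'rV[F]_n,
      (\sum_(i < (covering_radius C).+1) beta i * (nb_at_dist C x i)%:R = 1)%R.

(* Main.v *)
Require Import Defs.
From mathcomp Require Import all_boot all_order all_algebra all_field.
From mathcomp Require Import zify ring.

Set Implicit Arguments.
Unset Strict Implicit.
Unset Printing Implicit Defensive.

Import GRing.Theory Order.TTheory Num.Theory.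

(** Both halves are read off from the position sets on which a fixed word [v]
    agrees with codewords [c]. If [C] is MDS of dimension [K], two codewords that
    agree in [K] positions are equal, and values prescribed in at most [K]
    positions are interpolated by a codeword ([mds_inj], [mds_interpolation]).
    Write [q] for [2 ^ m] and [n] for [q + 2].

    Dimension [q - 1]. For a set [T] of at most [K] positions the number of
    codewords agreeing with [v] on [T] does not depend on [v]. Summing over [T] of
    given size yields triangular equations that determine the whole distance
    distribution of [v] from its entries below [n - K], which is [3]
    ([mds_nb_at_dist]). The minimum distance is [4], so these three entries
    are forced by the distance of [v] to [C], except for the number of codewords
    at distance [2] from a word at distance [2]. That number is [n / 2]: every
    position is changed by exactly one of these codewords ([nb_at_dist2]).

    Dimension [3]. The columns of a generator matrix form a hyperoval. Since
    complete regularity implies uniform packing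
    ([completely_regular_uniformly_packed]), only uniform packing has to be
    refuted. Multiply a packing identity by the character [x |-> (-1) ^ Tr (u . x)]
    of a dual word [u] and sum over all [x]. After a binomial expansion of the
    coefficients the result is triangular in the weight of [u], so if dual words of
    all weights from [n - r] to [n] exist, with [r] the covering radius, all
    coefficients vanish ([not_uniformly_packed_dual_words]). Dual words of all
    weights [4], ..., [n] do exist ([dual_word_weight]), so it remains to prove
    [r <= n - 4].

    Suppose on the contrary that [v] agrees with every codeword in at most three
    positions. By pigeonhole, a codeword that agrees with [v] twice does so exactly
    three times ([agree_third]). Geometrically, the hyperoval lifts to an arc
    of [q + 3] points of [PG(3, q)] meeting every plane in [0], [1] or [3] points. For
    a point on no secant of that arc, the planes through the point cut the arc in the
    blocks of a Steiner triple system of order [q + 3], whose number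
    [(q + 3)(q + 2) / 6] is not an integer when [q = 2 mod 3], that is, when [m] is odd.
    In terms of codewords, the planes through such a point correspond to the codewords
    [c] with [dot w c = tau], for a functional [dot w] and a suitable value [tau], apart
    from those planes that contain the added arc point. Counting the ordered pairs of
    positions where [v] agrees with one of these codewords gives the contradiction
    ([no_deep_hole]). *)

(** * Finite sets *)

Lemma pigeonhole (T R : finType) (f : T -> R) (D : {set T}) (E : {set R}) :
  (forall x, x \in D -> f x \in E) -> #|E| < #|D| ->
  exists x y, [/\ x \in D, y \in D, x != y & f x = f y].
Proof.
move=> fDE ltED; case: (boolP (dinjectiveb f (mem D))) => [/dinjectiveP injf|].
  have sub : f @: D \subset E by apply/subsetP=> _ /imsetP[x Dx ->]; apply: fDE.
  by move: (subset_leq_card sub); rewrite card_in_imset // leqNgt ltED.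
case/dinjectivePn=> x Dx [y /andP[/= neyx Dy] fxy].
by exists x, y; split=> //; rewrite eq_sym.
Qed.

Lemma extend_set (T : finType) (A : {set T}) k :
  #|A| <= k <= #|T| -> exists2 B : {set T}, A \subset B & #|B| = k.
Proof.
case/andP=> leAk leT.
have: 0 < #|[set B : {set T} | B \subset ~: A & #|B| == k - #|A|]|.
  by rewrite cards_draws bin_gt0 (cardsCs (~: A)) setCK; lia.
case/card_gt0P=> B; rewrite inE => /andP[sBA /eqP cB].
exists (A :|: B); first exact: subsetUl.
by rewrite cardsU disjoint_setI0 ?cards0 1?disjoint_sym ?disjoints_subset // cB; lia.
Qed.

Lemma other_index n (A : {set 'I_n}) : #|A| < n -> exists i, i \notin A.
Proof.
move=> ltA; have /card_gt0P[i] : 0 < #|~: A|.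
  by rewrite (cardsCs (~: A)) setCK card_ord; lia.
by rewrite inE => iA; exists i.
Qed.

(** * Agreement sets *)

Section Agreement.

Variables (F : finFieldType) (n : nat).
Implicit Types (u v w x y c e : 'rV[F]_n) (i j : 'I_n) (T : {set 'I_n}).

Definition agree v x : {set 'I_n} := [set i | v ord0 i == x ord0 i].

Lemma agreeE v x i : (i \in agree v x) = (v ord0 i == x ord0 i).
Proof. by rewrite inE. Qed.

Lemma hdist_disagree v x : hdist v x = #|~: agree v x|.
Proof. by apply: eq_card => i; rewrite !inE. Qed.

Lemma hdistE v x : hdist v x = n - #|agree v x|.
Proof. by rewrite hdist_disagree cardsCs setCK card_ord. Qed.

Lemma card_agree_le v x : #|agree v x| <= n.
Proof. by rewrite -[n in _ <= n]card_ord max_card. Qed.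

Lemma hdistC v x : hdist v x = hdist x v.
Proof.
by rewrite !hdistE; congr (n - #|pred_of_set _|); apply/setP=> i; rewrite !inE eq_sym.
Qed.

Lemma hdist_triangle x v y : hdist x y <= hdist x v + hdist v y.
Proof.
rewrite /hdist -cardsUI; apply: leq_trans (leq_addr _ _).
apply/subset_leq_card/subsetP=> i; rewrite !inE.
by apply: contraR; rewrite negb_or !negbK => /andP[/eqP-> /eqP->].
Qed.

Variable C : {vspace 'rV[F]_n}.

Lemma min_dist_le x y : x \in C -> y \in C -> x != y -> min_dist C <= hdist x y.
Proof.
move=> Cx Cy xy; rewrite /min_dist -Order.NatOrder.minEnat -leEnat.
by apply: (@bigmin_le_cond _ _ _ n (x, y) _ (fun p => hdist p.1 p.2)); rewrite /= Cx Cy.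
Qed.

Lemma dist_codeP v :
  exists c, [/\ c \in C, hdist v c = dist_code v C &
                forall x, x \in C -> dist_code v C <= hdist v x].
Proof.
rewrite /dist_code; case: arg_minnP; first exact: mem0v.
by move=> c Cc minc; exists c; split.
Qed.

Lemma dist_code_le v : dist_code v C <= covering_radius C.
Proof. exact: (leq_bigmax (F := fun v => dist_code v C)). Qed.

Lemma covering_radius_le r :
  (forall v, exists2 c, c \in C & hdist v c <= r) -> covering_radius C <= r.
Proof.
move=> H; apply/bigmax_leqP=> v _; have [c Cc lec] := H v.
by have [c' [_ _ mind]] := dist_codeP v; apply: leq_trans lec; apply: mind.
Qed.

Lemma hdist_le v x : hdist v x <= n.
Proof. by rewrite hdistE leq_subr. Qed.

Lemma covering_radius_le_length : covering_radius C <= n.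
Proof. by apply: covering_radius_le => v; exists 0%R; rewrite ?mem0v ?hdist_le. Qed.

Lemma nb_at_dist_below x s : s < dist_code x C -> nb_at_dist C x s = 0.
Proof.
move=> ltd; apply: eq_card0 => c; rewrite !inE; apply/negP=> /andP[Cc /eqP dc].
by have [_ [_ _ /(_ c Cc)]] := dist_codeP x; rewrite dc leqNgt ltd.
Qed.

End Agreement.

(** * MDS codes: information sets *)

Section MDS.

Variables (F : finFieldType) (n : nat) (C : {vspace 'rV[F]_n}).
Hypothesis mdsC : mds C.
Implicit Types (v w x y c e : 'rV[F]_n) (i j : 'I_n) (T : {set 'I_n}).

Lemma dim_le_length : \dim C <= n.
Proof. by have := dimvS (subvf C); rewrite dimvf /dim /= mul1n. Qed.

(** The minimum distance of an MDS code exceeds the number of positions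
    outside a set of [\dim C] positions. *)
Lemma mds_inj c e T : c \in C -> e \in C -> \dim C <= #|T| ->
  {in T, forall i, c ord0 i = e ord0 i} -> c = e.
Proof.
move=> Cc Ce leT agT; apply/eqP/negPn/negP=> nce.
have := min_dist_le Cc Ce nce; rewrite mdsC hdistE.
have: #|T| <= #|agree c e|.
  by apply/subset_leq_card/subsetP=> i iT; rewrite agreeE agT.
by have := dim_le_length; have := card_agree_le c e; lia.
Qed.

(** Restriction to [\dim C] positions is injective on [C] by [mds_inj], and
    [C] has as many elements as there are words on these positions. *)
Lemma mds_interpolation v T : #|T| <= \dim C ->
  exists2 c, c \in C & {in T, forall i, c ord0 i = v ord0 i}.
Proof.
move=> leT; have [|T' sTT' cT'] := @extend_set _ T (\dim C).
  by rewrite leT card_ord dim_le_length.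
suff [c Cc eqc] : exists2 c, c \in C & {in T', forall i, c ord0 i = v ord0 i}.
  by exists c => // i /(subsetP sTT'); apply: eqc.
pose r x := [ffun i : {i | i \in T'} => x ord0 (val i)].
have injr : {in [set c in C] &, injective r}.
  move=> c e; rewrite !inE => Cc Ce /ffunP rce.
  apply: (@mds_inj _ _ T') => //; first by rewrite cT'.
  by move=> i iT; have := rce (exist _ i iT); rewrite !ffunE.
have imr : r @: [set c in C] = [set: {ffun {i | i \in T'} -> F}].
  apply/eqP; rewrite eqEcard subsetT card_in_imset // cardsT card_ffun card_sig.
  by rewrite cardsE card_vspace -cT' [X in _ ^ X <= _](_ : _ = #|T'|) ?leqnn //.
have /imsetP[c] : r v \in r @: [set c in C] by rewrite imr inE.
rewrite inE => Cc /ffunP rvc; exists c => // i iT.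
by have := rvc (exist _ i iT); rewrite !ffunE.
Qed.

End MDS.

(** * Coset weight distributions *)

Section Moments.

Variables (F : finFieldType) (n : nat) (C : {vspace 'rV[F]_n}).
Hypothesis mdsC : mds C.
Implicit Types (v w x y c e : 'rV[F]_n) (i j : 'I_n) (T : {set 'I_n}).

Definition agreeing v T : {set 'rV[F]_n} := [set c in C | T \subset agree v c].

(** Subtracting a codeword that interpolates [v] on [T] carries one set to
    the other. *)
Lemma card_agreeing v T : #|T| <= \dim C -> #|agreeing v T| = #|agreeing 0%R T|.
Proof.
move=> leT; have [c0 Cc0 eqc0] := mds_interpolation mdsC v leT.
rewrite -[RHS](card_imset _ (addIr c0)); apply: eq_card => x; rewrite inE.
apply/andP/imsetP => [[Cx /subsetP agx]|[y]].
  exists (x - c0)%R; last by rewrite subrK.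
  rewrite inE memvB //=; apply/subsetP=> i iT; have := agx i iT.
  by rewrite !agreeE !mxE -eqc0 // => /eqP->; rewrite subrr.
rewrite inE => /andP[Cy /subsetP agy] ->; rewrite memvD //; split=> //.
apply/subsetP=> i iT; have := agy i iT.
by rewrite !agreeE !mxE => /eqP<-; rewrite add0r eqc0.
Qed.

(** Both sides count pairs of a codeword [c] and a [t]-subset of the positions
    where [c] agrees with [v]. *)
Lemma sum_bin_agree v (t : nat) :
  \sum_(c in C) 'C(#|agree v c|, t) = \sum_(T : {set 'I_n} | #|T| == t) #|agreeing v T|.
Proof.
under eq_bigr => c _ do rewrite -cards_draws -sum1_card.
under [RHS]eq_bigr => T _ do rewrite -sum1_card.
rewrite (exchange_big_dep (fun T => #|T| == t)) /=; last first.
  by move=> c T _; rewrite inE => /andP[].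
apply: eq_bigr => T cT; apply: eq_bigl => c.
by rewrite !inE cT andbT.
Qed.

Lemma sum_nb_at_dist v (f : nat -> nat) :
  \sum_(c in C) f #|agree v c| = \sum_(s < n.+1) nb_at_dist C v s * f (n - s).
Proof.
rewrite (partition_big (fun c => inord (hdist v c) : 'I_n.+1) predT) //=.
apply: eq_bigr => s _; have les : s <= n by rewrite -ltnS.
rewrite -sum_nat_const; apply: eq_big => c.
  by rewrite inE; congr andb; rewrite -val_eqE /= inordK // ltnS hdist_le.
case/andP=> _ /eqP <-; rewrite inordK ?ltnS ?hdist_le // hdistE.
by rewrite subKn ?card_agree_le.
Qed.

(** By [card_agreeing] and [sum_bin_agree], for [j <= \dim C] the sum over [s]
    of [nb_at_dist C v s * 'C(n - s, j)] is the same for all [v]. With [j = n - t] the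
    entries [s > t] drop out and the entry [t] has coefficient [1]. *)
Lemma mds_nb_at_dist v w :
  (forall s, s < n - \dim C -> nb_at_dist C v s = nb_at_dist C w s) ->
  forall t, t <= n -> nb_at_dist C v t = nb_at_dist C w t.
Proof.
move=> low; elim/ltn_ind => t IH letn.
have [|get] := ltnP t (n - \dim C); first exact: low.
have lej : n - t <= \dim C by lia.
have eqT : \sum_(T : {set 'I_n} | #|T| == n - t) #|agreeing v T| =
            \sum_(T : {set 'I_n} | #|T| == n - t) #|agreeing w T|.
  apply: eq_bigr => T /eqP cT.
  by rewrite (card_agreeing v) ?(card_agreeing w) ?cT.
have mom x := etrans (esym (sum_nb_at_dist x (fun a => 'C(a, n - t))))
                     (sum_bin_agree x (n - t)).
have := etrans (mom v) (etrans eqT (esym (mom w))).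
have lt_t : t < n.+1 by [].
rewrite (bigD1 (Ordinal lt_t)) //= [RHS](bigD1 (Ordinal lt_t)) //= binn !muln1.
rewrite [X in _ + X = _](_ : _ =
  \sum_(s < n.+1 | s != Ordinal lt_t) nb_at_dist C w s * 'C(n - s, n - t)).
  by move/eqP; rewrite eqn_add2r => /eqP.
apply: eq_bigr => s; rewrite -val_eqE /= => nest.
have [lts|ges] := ltnP s t; first by rewrite IH // -ltnS.
by rewrite bin_small ?muln0 //; have := ltn_ord s; lia.
Qed.

End Moments.

(** * Dual hyperoval codes are completely regular *)

Section DualHyperoval.

Variables (F : finFieldType) (n : nat) (C : {vspace 'rV[F]_n}).
Hypotheses (mdsC : mds C) (nE : n = #|F| + 2) (dimC : \dim C = n - 3).
Implicit Types (v w x y c e : 'rV[F]_n) (i j : 'I_n) (T : {set 'I_n}).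

Let q_gt1 : 1 < #|F|. Proof. exact: finNzRing_gt1. Qed.

Lemma card_set3 i j l : #|[set i; j; l]| <= 3.
Proof. by rewrite !cardsU !cards1; lia. Qed.

Lemma card_away2 i j : i != j -> #|[set l | (l != i) && (l != j)]| = #|F|.
Proof.
move=> nij; rewrite cardsCs card_ord.
rewrite [~: _](_ : _ = [set i; j]) ?cards2 ?nij ?nE ?addnK //.
by apply/setP=> l; rewrite !inE negb_and !negbK.
Qed.

Lemma dual_hyperoval_inj c e i j l : c \in C -> e \in C ->
  (forall k, k \notin [set i; j; l] -> c ord0 k = e ord0 k) -> c = e.
Proof.
move=> Cc Ce eqce; apply: (mds_inj mdsC (T := ~: [set i; j; l])) => //.
  rewrite [X in _ <= X]cardsCs setCK card_ord dimC.
  by rewrite leq_sub2l ?card_set3.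
by move=> k; rewrite inE => /eqce.
Qed.

(** For [l] outside [{i, j}] let [c_l] be the codeword that agrees with [v] off
    [{i, j, l}]. There are [q] choices of [l]. Either some [c_l] has the value of [v]
    at [j], and agrees with [v] off [{i, l}]; or two of them, [c_l] and [c_l'], which
    take only [q - 1] values at [j], coincide there. Then they differ only in
    [{i, l, l'}], so they are equal, and agree with [v] off [{i, j}]. As no codeword is
    closer than [2] to [v], both altered positions do occur. *)
Lemma word_of_weight2 v i : (forall c, c \in C -> 2 <= hdist v c) ->
  exists c, [/\ c \in C, hdist v c = 2 & i \notin agree v c].
Proof.
move=> far; have [|j] := @other_index n [set i]; first by rewrite cards1; lia.
rewrite inE eq_sym => nij.
suff [c [l [Cc agc]]] : exists c l,
    c \in C /\ forall k, k \notin [set i; l] -> v ord0 k = c ord0 k.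
  have sub : ~: agree v c \subset [set i; l].
    by apply/subsetP=> k; rewrite inE agreeE; apply: contraR => /agc->.
  have := far c Cc; have := subset_leq_card sub.
  rewrite cards2 -hdist_disagree => le2 ge2.
  have d2 : hdist v c = 2 by move: le2; case: (i != l); lia.
  exists c; split=> //.
  have /eqP : ~: agree v c == [set i; l].
    by rewrite eqEcard sub cards2 -hdist_disagree d2; case: (i != l).
  by move/setP/(_ i); rewrite in_setC => ->; rewrite !inE eqxx.
pose D := [set l | (l != i) && (l != j)].
pose good l c :=
  (c \in C) && [forall k, (k \notin [set i; j; l]) ==> (v ord0 k == c ord0 k)].
pose cw l := odflt 0%R [pick c | good l c].
have cwP l : l \in D ->
    cw l \in C /\ forall k, k \notin [set i; j; l] -> v ord0 k = cw l ord0 k.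
  rewrite inE => /andP[nli nlj]; rewrite /cw; case: pickP => [c /andP[Cc /forallP agc]|none].
    by split=> // k kn; apply/eqP; have := agc k; rewrite kn.
  have [|c Cc agc] := mds_interpolation mdsC v (T := ~: [set i; j; l]).
    rewrite cardsCs setCK card_ord dimC; apply: leq_sub2l.
    by rewrite setUC cardsU1 cards2 !inE negb_or nli nlj nij.
  case/idP: (none c); rewrite /good Cc; apply/forallP=> k; apply/implyP=> kn.
  by rewrite agc // inE.
have D_gt : #|[set~ v ord0 j]| < #|D| by rewrite cardsC1 card_away2 // ltn_predL ltnW.
case: (boolP [exists l in D, cw l ord0 j == v ord0 j]) => [/exists_inP[l Dl /eqP cj]|].
  have [Ccl agl] := cwP l Dl; exists (cw l), l; split=> // k; rewrite !inE.
  have [->|nkj] := eqVneq k j; first by rewrite cj.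
  by move=> kil; apply: agl; rewrite !inE orbAC (negPf nkj) orbF.
rewrite negb_exists_in => /forall_inP nocj.
have [l Dl|l [l' [Dl Dl' nll' eqj]]] := pigeonhole (f := fun l => cw l ord0 j) (D := D) _ D_gt.
  by rewrite !inE nocj.
have [[Cl agl] [Cl' agl']] := (cwP l Dl, cwP l' Dl').
have eqcw : cw l = cw l'.
  apply: (@dual_hyperoval_inj _ _ i l l') => // k.
  have [->//|nkj] := eqVneq k j.
  rewrite !inE !negb_or -andbA => /and3P[ki kl kl'].
  by rewrite -agl ?agl' // !inE !negb_or ki nkj.
exists (cw l), j; split=> // k; rewrite !inE !negb_or => /andP[ki kj].
have [ekl|nkl] := eqVneq k l; last by apply: agl; rewrite !inE !negb_or ki kj.
by rewrite eqcw; apply: agl'; rewrite !inE !negb_or ki kj ekl.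
Qed.

(** Two codewords at distance [2] from [v], both altering [v] at [i], differ in
    at most three positions. Hence the sets of altered positions partition all
    positions into pairs. *)
Lemma nb_at_dist2 v : dist_code v C = 2 -> 2 * nb_at_dist C v 2 = n.
Proof.
move=> dv; have [_ [_ _ far]] := dist_codeP C v; rewrite dv in far.
pose W := [set c in C | hdist v c == 2].
have W_unique i : #|[set c in W | i \notin agree v c]| = 1.
  have [c [Cc dc ic]] := word_of_weight2 i far.
  apply/eqP/cards1P; exists c; apply/setP=> e; rewrite !inE.
  apply/idP/eqP => [/andP[/andP[Ce /eqP de] ie]|->]; last by rewrite Cc dc eqxx -agreeE.
  pose A := (~: agree v c) :|: (~: agree v e).
  have A_le : #|A| <= 3.
    have : 0 < #|~: agree v c :&: ~: agree v e|.
      by apply/card_gt0P; exists i; rewrite !inE ie -agreeE ic.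
    by rewrite /A cardsU -!hdist_disagree dc de; lia.
  apply: (mds_inj mdsC (T := ~: A)) => //.
    by rewrite [X in _ <= X]cardsCs setCK card_ord dimC; lia.
  by move=> k; rewrite !inE negb_or !negbK => /andP[/eqP<- /eqP<-].
have -> : nb_at_dist C v 2 = #|W| by apply: eq_card => c; rewrite !inE.
rewrite mulnC -sum_nat_const; transitivity (\sum_(i < n) 1); last first.
  by rewrite sum1_card card_ord.
rewrite [RHS](eq_bigr (fun i => \sum_(c in W | i \notin agree v c) 1)); last first.
  by move=> i _; rewrite -[LHS](W_unique i) -sum1_card; apply: eq_bigl => c; rewrite inE.
rewrite (exchange_big_dep (mem W)) /=; last by move=> i c _ /andP[].
apply: eq_bigr => c Wc; have /eqP dc : hdist v c == 2 by move: Wc; rewrite inE => /andP[].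
by rewrite -[LHS]dc hdist_disagree -sum1_card; apply: eq_bigl => i; rewrite Wc in_setC.
Qed.

(** The minimum distance is [4]. If [s + dist_code x C <= 3], the nearest codeword
    to [x] is the only one that can have distance [s] to [x], by the triangle inequality.
    With [dist_code x C <= s <= 2] the only case left is [nb_at_dist2]. *)
Lemma dual_hyperoval_completely_regular : completely_regular C.
Proof.
have dmin x y : x \in C -> y \in C -> x != y -> 4 <= hdist x y.
  move=> Cx Cy nxy; apply: leq_trans (min_dist_le Cx Cy nxy).
  by rewrite mdsC dimC; lia.
move=> v w t letn dvw; apply: (mds_nb_at_dist mdsC) => // s {t letn}.
rewrite dimC => lts; have {lts} les : s <= 2 by lia.
have near x : s + dist_code x C <= 3 -> nb_at_dist C x s = (s == dist_code x C).
  move=> lesd; have [c [Cc dc minc]] := dist_codeP C x.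
  rewrite -dc; rewrite -dc in lesd; have [es|ns] := eqVneq s (hdist x c); last first.
    apply: eq_card0 => e; rewrite !inE; apply/negP=> /andP[Ce /eqP de].
    have [ece|nec] := eqVneq e c; first by rewrite -ece de eqxx in ns.
    by have := dmin _ _ Ce Cc nec; have := hdist_triangle e x c; rewrite (hdistC e x) de; lia.
  transitivity #|[set c]|; last by rewrite cards1.
  apply: eq_card => e; rewrite !inE.
  apply/andP/eqP => [[Ce /eqP de]|->]; last by rewrite Cc es eqxx.
  apply/eqP; apply: contraLR lesd => nec; have := dmin _ _ Ce Cc nec.
  by have := hdist_triangle e x c; rewrite (hdistC e x) de -es; lia.
have [ltd|ged] := ltnP s (dist_code v C); first by rewrite !nb_at_dist_below -?dvw.
have [les3|gts3] := leqP (s + dist_code v C) 3; first by rewrite !near -?dvw.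
have dv2 : dist_code v C = 2 by lia.
have -> : s = 2 by lia.
by have := nb_at_dist2 dv2; have := nb_at_dist2 (etrans (esym dvw) dv2); lia.
Qed.

End DualHyperoval.

(** * Complete regularity implies uniform packing *)

Section UniformPacking.

Variables (F : finFieldType) (n : nat) (C : {vspace 'rV[F]_n}).
Implicit Types (v w x y c e : 'rV[F]_n).

Local Open Scope ring_scope.

Lemma nb_at_dist_code_gt0 x : (0 < nb_at_dist C x (dist_code x C))%N.
Proof.
have [c [Cc dc _]] := dist_codeP C x.
by apply/card_gt0P; exists c; rewrite inE Cc dc eqxx.
Qed.

(** Under complete regularity the identity for [x] depends only on the distance
    of [x] to [C], and for distance [e] it involves only the coefficients from [e] on,
    that of [e] being multiplied by a positive number. So the coefficients can be solved
    for in decreasing order; a coefficient whose distance does not occur is arbitrary. *)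
Lemma completely_regular_uniformly_packed :
  completely_regular C -> uniformly_packed C.
Proof.
move=> crC; set r := covering_radius C.
suff H k : (k <= r.+1)%N -> exists b : nat -> rat,
    forall x, (r < dist_code x C + k)%N ->
    \sum_(i < r.+1) b i * (nb_at_dist C x i)%:R = 1.
  have [b eqb] := H _ (leqnn _).
  by exists b => x; apply: eqb; rewrite addnS ltnS leq_addl.
elim: k => [|k IH] lek.
  by exists (fun=> 0) => x; rewrite addn0 ltnNge dist_code_le.
have [b eqb] := IH (ltnW lek); pose e := (r - k)%N.
have split_case x : (r < dist_code x C + k.+1)%N ->
    (r < dist_code x C + k)%N /\ (e < dist_code x C)%N \/ dist_code x C = e.
  by rewrite /e; lia.
case: (pickP (fun x => dist_code x C == e)) => [x0 /eqP dx0|none]; last first.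
  exists b => x /split_case[[/eqb]//|/eqP dx]; by rewrite none in dx.
have lte : (e < r.+1)%N by rewrite /e ltnS leq_subr.
pose rest := \sum_(i < r.+1 | i != Ordinal lte) b i * (nb_at_dist C x0 i)%:R.
pose b' i := if i == e then (1 - rest) / (nb_at_dist C x0 e)%:R else b i.
exists b' => x /split_case[[ltk lted]|dx].
  rewrite -[RHS](eqb x ltk); apply: eq_bigr => i _; rewrite /b'.
  by case: eqP => // ->; rewrite (nb_at_dist_below lted) mulr0n !mulr0.
have eqB i : (i < r.+1)%N -> nb_at_dist C x i = nb_at_dist C x0 i.
  rewrite ltnS => lei; apply: crC; last by rewrite dx.
  exact: leq_trans lei (covering_radius_le_length C).
rewrite (bigD1 (Ordinal lte)) //= {1}/b' eqxx (eqB _ lte) divfK; last first.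
  by rewrite pnatr_eq0 -lt0n -dx0 nb_at_dist_code_gt0.
rewrite (eq_bigr (fun i : 'I_r.+1 => b i * (nb_at_dist C x0 i)%:R)) ?subrK // => i ne.
have nie : (i : nat) != e by move: ne; rewrite -val_eqE.
by rewrite eqB // /b' (negPf nie).
Qed.

End UniformPacking.

(** * Additive characters in characteristic two *)

Section Character.

Variables (F : finFieldType) (m : nat).
Hypotheses (m_gt0 : 0 < m) (cardF : #|F| = 2 ^ m).
Local Open Scope ring_scope.
Implicit Types a b : F.

Let pchar2 : 2%N \in [pchar F].
Proof. exact: (card_finPcharP cardF). Qed.

Definition absolute_trace a : F := \sum_(i < m) a ^+ (2 ^ i).
Local Notation Tr := absolute_trace.

Lemma absolute_traceD a b : Tr (a + b) = Tr a + Tr b.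
Proof.
rewrite /Tr -big_split /=; apply: eq_bigr => i _; apply: exprDn_pchar.
by rewrite pnatX pnatE // pchar2.
Qed.

(** The squaring map permutes the summands of the trace cyclically, so it fixes
    the trace. *)
Lemma absolute_trace01 a : (Tr a == 0) || (Tr a == 1).
Proof.
have : Tr a ^+ 2 = Tr a.
  have -> : Tr a ^+ 2 = \sum_(i < m) a ^+ (2 ^ i.+1).
    rewrite -(pFrobenius_autE pchar2) rmorph_sum /=; apply: eq_bigr => i _.
    by rewrite pFrobenius_autE -exprM expnSr.
  rewrite /Tr; case: m cardF => [|m'] cF; first by rewrite !big_ord0.
  rewrite big_ord_recr /= -cF expf_card [RHS]big_ord_recl /= expr1 addrC.
  by congr +%R.
move/eqP; rewrite -subr_eq0 expr2 -{3}[Tr a]mulr1 -mulrBr mulf_eq0.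
by rewrite [X in _ || X]subr_eq0.
Qed.

(** The trace is a nonzero polynomial of degree [2 ^ (m - 1)], which is less
    than [#|F|], so it cannot vanish on all of [F]. *)
Lemma absolute_trace_surj : exists a, Tr a = 1.
Proof.
case: (pickP (fun a => Tr a != 0)) => [a nz|Tr0].
  by exists a; have := absolute_trace01 a; rewrite (negPf nz) => /eqP.
pose P : {poly F} := \sum_(i < m) 'X^(2 ^ i).
have szP : (size P <= (2 ^ m.-1).+1)%N.
  apply: (leq_trans (size_sum _ _ _)); apply/bigmax_leqP=> i _.
  by rewrite size_polyXn ltnS leq_pexp2l //; have := ltn_ord i; lia.
have P1 : P`_1 = 1.
  rewrite /P coef_sum (bigD1 (Ordinal m_gt0)) //= coefXn eqxx big1 ?addr0 // => i.
  rewrite -val_eqE /= => i0; rewrite coefXn; case: eqP => // e1.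
  by have : (2 ^ 1 <= 2 ^ i)%N by [rewrite leq_exp2l // lt0n]; rewrite -e1.
have nzP : P != 0 by apply/eqP=> P0; move/eqP: P1; rewrite P0 coef0 eq_sym oner_eq0.
have : all (root P) (enum F).
  apply/allP=> a _; rewrite /root horner_sum.
  rewrite (eq_bigr (fun i : 'I_m => a ^+ (2 ^ i))) => [|i _]; last by rewrite hornerXn.
  exact/negbFE/Tr0.
move/(max_poly_roots nzP)/(_ (enum_uniq _)); rewrite -cardE cardF => lt_sz.
have := leq_trans lt_sz szP; rewrite ltnS leqNgt ltn_exp2l //; lia.
Qed.

Definition binary_char a : rat := if Tr a == 0 then 1 else -1.
Local Notation chi := binary_char.

Lemma binary_charD a b : chi (a + b) = chi a * chi b.
Proof.
rewrite /chi absolute_traceD.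
case/orP: (absolute_trace01 a) => /eqP->; case/orP: (absolute_trace01 b) => /eqP->.
- by rewrite addr0 eqxx mul1r.
- by rewrite add0r eqxx mul1r.
- by rewrite addr0 eqxx mulr1.
- by rewrite addrr_pchar2 // eqxx oner_eq0 mulrNN mul1r.
Qed.

Lemma binary_char0 : chi 0 = 1.
Proof.
rewrite /chi /Tr big1 ?eqxx // => i _.
by rewrite expr0n expn_eq0.
Qed.

Lemma binary_char_nontrivial : exists a, chi a = -1.
Proof. by have [a Tra] := absolute_trace_surj; exists a; rewrite /chi Tra oner_eq0. Qed.

End Character.

(** * Dual words obstruct uniform packing *)

(** The coefficients are determined in increasing order of [t], and vanish as
    long as [g] does. *)
Lemma newton_expansion (g : nat -> rat) (a0 N : nat) :
  (forall a, a < a0 -> g a = 0%R) ->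
  exists2 gam : nat -> rat, (forall t, t < a0 -> gam t = 0%R) &
    forall a, a < N -> g a = (\sum_(t < N) gam t * 'C(a, t)%:R)%R.
Proof.
move=> g0; suff H k : k <= N -> exists2 gam : nat -> rat,
    (forall t, t < a0 -> gam t = 0%R) &
    forall a, a < k -> g a = (\sum_(t < N) gam t * 'C(a, t)%:R)%R.
  exact: H.
elim: k => [|k IH] ltk; first by exists (fun=> 0%R).
have [gam gam0 gamE] := IH (ltnW ltk).
pose del := (g k - \sum_(t < N) gam t * 'C(k, t)%:R)%R.
exists (fun t => gam t + (if t == k then del else 0))%R => [t ltt|a].
  rewrite gam0 // add0r; case: eqP => // etk.
  rewrite /del g0 -?etk // sub0r big1 ?oppr0 // => s _.
  have [lts|ges] := ltnP s a0; first by rewrite gam0 ?mul0r.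
  by rewrite bin_small ?mulr0 // (leq_trans ltt).
have sum_del : (\sum_(t < N) (if t == k :> nat then del else 0) * 'C(a, t)%:R =
    del * 'C(a, k)%:R)%R.
  rewrite (bigD1 (Ordinal ltk)) //= eqxx big1 ?addr0 // => s.
  by rewrite -val_eqE /= => /negPf->; rewrite mul0r.
under eq_bigr do rewrite mulrDl; rewrite big_split /= sum_del.
rewrite ltnS leq_eqVlt => /predU1P[->|lta]; first by rewrite binn mulr1 addrC subrK.
by rewrite bin_small // mulr0 addr0 -gamE.
Qed.

Section DualWords.

Variables (F : finFieldType) (n m : nat) (C : {vspace 'rV[F]_n}).
Hypotheses (m_gt0 : 0 < m) (cardF : #|F| = 2 ^ m).
Implicit Types (u v w x y c e : 'rV[F]_n) (i j : 'I_n) (T : {set 'I_n}).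

Local Open Scope ring_scope.

Definition dot u x : F := \sum_i u ord0 i * x ord0 i.

Definition dual_word u := forall c, c \in C -> dot u c = 0.

Definition word_support u : {set 'I_n} := [set i | u ord0 i != 0].

Lemma dotDr u x y : dot u (x + y) = dot u x + dot u y.
Proof. by rewrite /dot -big_split; apply: eq_bigr => i _; rewrite mxE mulrDr. Qed.

Lemma dotC u x : dot u x = dot x u.
Proof. by apply: eq_bigr => k _; rewrite mulrC. Qed.

Lemma dotZr u a x : dot u (a *: x) = a * dot u x.
Proof. by rewrite /dot mulr_sumr; apply: eq_bigr => k _; rewrite mxE mulrCA. Qed.

Lemma dot0r u : dot u 0 = 0.
Proof. by rewrite -(scale0r (0 : 'rV[F]_n)) dotZr mul0r. Qed.

Lemma dotNr u x : dot u (- x) = - dot u x.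
Proof. by rewrite -scaleN1r dotZr mulN1r. Qed.

Lemma dot_delta u i a : dot u (a *: delta_mx ord0 i) = u ord0 i * a.
Proof.
rewrite /dot (bigD1 i) //= big1 ?addr0 => [|j nj]; first by rewrite !mxE !eqxx mulr1.
by rewrite !mxE (negPf nj) andbF !mulr0.
Qed.

Lemma dot_agree u x y : word_support u \subset agree x y -> dot u x = dot u y.
Proof.
move/subsetP=> sub; apply: eq_bigr => i _.
have [->|nz] := eqVneq (u ord0 i) 0; first by rewrite !mul0r.
by have /eqP-> : x ord0 i == y ord0 i by rewrite -agreeE sub // inE.
Qed.

Definition character_sum u (f : 'rV[F]_n -> rat) : rat :=
  \sum_x binary_char m (dot u x) * f x.

(** Some shift along a coordinate where [u] is nonzero multiplies the character
    by [-1]; if [f] does not see that coordinate, the sum equals its opposite. *)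
Lemma character_sum_eq0 u f i : u ord0 i != 0 ->
  (forall x a, f (x + a *: delta_mx ord0 i) = f x) -> character_sum u f = 0.
Proof.
move=> nz inv; have [b chib] := binary_char_nontrivial m_gt0 cardF.
(* the scalar for which the shift by y multiplies the character by chi b = -1 *)
pose y : 'rV[F]_n := (u ord0 i)^-1 * b *: delta_mx ord0 i.
have : character_sum u f = - character_sum u f.
  rewrite /character_sum [LHS](reindex_inj (addIr y)) /= -sumrN.
  apply: eq_bigr => x _; rewrite inv dotDr (binary_charD cardF) dot_delta mulVKf //.
  by rewrite chib mulrN1 mulNr.
by move/eqP; rewrite -addr_eq0 -mulr2n mulrn_eq0 => /eqP.
Qed.

Lemma agreeing_shift x a i T : i \notin T ->
  agreeing C (x + a *: delta_mx ord0 i) T = agreeing C x T.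
Proof.
move=> iT; apply/setP=> c; rewrite !inE; congr andb.
apply/subsetP/subsetP => sub k kT; have := sub k kT;
  have nki : k != i by [apply: contraNneq iT => <-];
  by rewrite !agreeE !mxE (negPf nki) mulr0 addr0.
Qed.

(** A word [x] that contributes to the sum agrees on [T] with a codeword, to
    which [u] is orthogonal; as [T] contains the support of [u], the character is [1]
    at [x]. *)
Lemma character_sum_agreeing_neq0 u T : dual_word u -> word_support u \subset T ->
  character_sum u (fun x => #|agreeing C x T|%:R) != 0.
Proof.
move=> du sub; rewrite /character_sum gt_eqF //.
have chi1 x : (0 < #|agreeing C x T|)%N -> binary_char m (dot u x) = 1.
  case/card_gt0P=> c; rewrite inE => /andP[Cc agc].
  by rewrite (dot_agree (subset_trans sub agc)) du // binary_char0.
have ge0 x : 0 <= binary_char m (dot u x) * #|agreeing C x T|%:R.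
  by case: (posnP #|agreeing C x T|) => [->|/chi1->]; rewrite ?mulr0 // mul1r ler0n.
rewrite (bigD1 0) //= ltr_wpDr ?sumr_ge0 //.
have pos : (0 < #|agreeing C 0%R T|)%N.
  by apply/card_gt0P; exists 0; rewrite inE mem0v; apply/subsetP=> i _; rewrite agreeE.
by rewrite chi1 // mul1r ltr0n.
Qed.

(** In terms of the number [a] of agreements the packing coefficients vanish
    for [a < n - r]; expand them as [\sum_t gam t * 'C(a, t)]. Then the weighted sum of
    the functions [x |-> #|agreeing C x T|] with weight [gam #|T|] is the constant [1].
    Its character sum against a dual word [u] of weight [t] is [0]. On the other side
    only sets [T] containing the support of [u] survive, so once the coefficients
    above [t] are known to vanish, a nonzero multiple of [gam t] remains. *)
Lemma not_uniformly_packed_dual_words :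
  (forall t, (n - covering_radius C <= t <= n)%N ->
     (0 < t)%N /\ exists2 u, dual_word u & #|word_support u| = t) ->
  ~ uniformly_packed C.
Proof.
move=> duals [b eqb]; set r := covering_radius C in b eqb duals *.
(* the packing coefficient at distance n - a, or 0 if that exceeds the covering radius *)
pose g (a : nat) : rat := \sum_(i < r.+1) b i * (n - a == i)%N%:R.
have g0 a : (a < n - r)%N -> g a = 0.
  move=> lta; rewrite /g big1 // => i _; have := ltn_ord i.
  by case: eqP => [|_ _]; [lia | rewrite mulr0].
have sum_g x : \sum_(c in C) g #|agree x c| = 1.
  rewrite -[RHS](eqb x) /g exchange_big /=; apply: eq_bigr => i _.
  rewrite -mulr_sumr; congr (_ * _); rewrite -natr_sum; congr _%:R.
  rewrite /nb_at_dist -sum1_card big_mkcond [RHS]big_mkcond /=.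
  by apply: eq_bigr => c _; rewrite inE hdistE; case: (c \in C) => //=; case: eqP.
have [gam gam0 gamE] := newton_expansion n.+1 g0.
have sum_gam x : \sum_(t < n.+1) gam t *
    (\sum_(T : {set 'I_n} | #|T| == t) #|agreeing C x T|)%:R = 1.
  rewrite -[RHS](sum_g x).
  transitivity (\sum_(c in C) \sum_(t < n.+1) gam t * 'C(#|agree x c|, t)%:R).
    rewrite exchange_big /=; apply: eq_bigr => t _.
    by rewrite -sum_bin_agree natr_sum mulr_sumr.
  by apply: eq_bigr => c _; rewrite gamE // ltnS card_agree_le.
suff gamz t : (t <= n)%N -> gam t = 0.
  have := sum_gam 0; rewrite big1 => [/esym/eqP|t _]; first by rewrite oner_eq0.
  by rewrite gamz ?mul0r // -ltnS.
move: {2}(n - t)%N (leqnn (n - t)) => k.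
elim/ltn_ind: k t => k IH t lek let_n.
have [/gam0//|ge_t] := ltnP t (n - r).
have [|t0 [u du su]] := duals t; first by rewrite ge_t.
have [i iW] : exists i, i \in word_support u by apply/card_gt0P; rewrite su.
have ui : u ord0 i != 0 by rewrite inE in iW.
have gam_gt s : (t < s <= n)%N -> gam s = 0.
  by case/andP=> ts sn; apply: (IH (n - s)%N) => //; lia.
have : character_sum u (fun=> 1) = 0 by apply: character_sum_eq0 ui _.
pose L s := character_sum u (fun x =>
  (\sum_(T : {set 'I_n} | #|T| == s) #|agreeing C x T|)%:R).
have -> : character_sum u (fun=> 1) = \sum_(s < n.+1) gam s * L s.
  rewrite /character_sum.
  under eq_bigr => x _ do rewrite -(sum_gam x) mulr_sumr.
  rewrite exchange_big; apply: eq_bigr => s _; rewrite mulr_sumr.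
  by apply: eq_bigr => x _; rewrite mulrCA.
have LE s : L s = \sum_(T : {set 'I_n} | #|T| == s)
    character_sum u (fun x => #|agreeing C x T|%:R).
  rewrite /L /character_sum exchange_big; apply: eq_bigr => x _.
  by rewrite natr_sum mulr_sumr.
have sum0 T : ~~ (word_support u \subset T) ->
    character_sum u (fun x => #|agreeing C x T|%:R) = 0.
  case/subsetPn=> j; rewrite inE => uj jT; apply: (character_sum_eq0 uj) => x a.
  by rewrite agreeing_shift.
have ltt : (t < n.+1)%N by rewrite ltnS.
rewrite (bigD1 (Ordinal ltt)) //= big1 ?addr0 => [|s]; last first.
  rewrite -val_eqE /= => nst; have [lts|les] := ltnP t s.
    by rewrite gam_gt ?mul0r // lts -ltnS ltn_ord.
  rewrite LE big1 ?mulr0 // => T /eqP cT; apply: sum0; apply/negP=> /subset_leq_card.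
  by rewrite su cT; lia.
move/eqP; rewrite mulf_eq0 => /orP[/eqP//|].
rewrite LE (bigD1 (word_support u)) ?su //= big1 ?addr0 => [|T /andP[/eqP cT nT]].
  by rewrite (negPf (character_sum_agreeing_neq0 du (subxx _))).
by apply: sum0; apply: contra nT => sub; rewrite eq_sym eqEcard sub su cT leqnn.
Qed.

End DualWords.

(** * Dual words of hyperoval codes *)

Section Hyperoval.

Variables (F : finFieldType) (n : nat) (C : {vspace 'rV[F]_n}).
Hypotheses (mdsC : mds C) (nE : n = #|F| + 2) (dimC : \dim C = 3).
Implicit Types (u v w x y z c e : 'rV[F]_n) (i j l : 'I_n) (T : {set 'I_n}).

Local Open Scope ring_scope.

Let q_gt1 : (1 < #|F|)%N. Proof. exact: finNzRing_gt1. Qed.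

Lemma card_triple i j l : i != j -> i != l -> j != l -> #|[set i; j; l]| = 3.
Proof.
move=> ij il jl.
by rewrite setUC cardsU1 cards2 !inE negb_or ![l == _]eq_sym il jl ij.
Qed.

Lemma agree3 c e i j l : c \in C -> e \in C -> i != j -> i != l -> j != l ->
  c ord0 i = e ord0 i -> c ord0 j = e ord0 j -> c ord0 l = e ord0 l -> c = e.
Proof.
move=> Cc Ce ij il jl ei ej el; apply: (mds_inj mdsC (T := [set i; j; l])) => //.
  by rewrite dimC card_triple.
by move=> k; rewrite !inE => /orP[/orP[]|] /eqP->.
Qed.

Lemma interpolate3 (a b d : F) i j l : i != j -> i != l -> j != l ->
  exists c, [/\ c \in C, c ord0 i = a, c ord0 j = b & c ord0 l = d].
Proof.
move=> ij il jl; pose v : 'rV[F]_n := \row_k if k == i then a else if k == j then b else d.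
have [|c Cc cv] := mds_interpolation mdsC v (T := [set i; j; l]).
  by rewrite dimC card_triple.
exists c; split=> //; rewrite cv ?inE ?eqxx ?orbT // mxE ?eqxx //.
  by rewrite eq_sym (negPf ij).
by rewrite ![l == _]eq_sym (negPf il) (negPf jl).
Qed.

Lemma third_index i j : exists l, i != l /\ j != l.
Proof.
have [|l] := @other_index n [set i; j]; first by rewrite cards2; case: (i != j); lia.
by rewrite !inE negb_or => /andP[li lj]; exists l; rewrite ![_ == l]eq_sym.
Qed.

(** The values of a codeword at [a], [b], [d] determine its value at [i]
    linearly. No coefficient of this relation is zero, since a nonzero codeword has at
    most two zeros. *)
Lemma dual_word4 i a b d : a != b -> a != d -> b != d -> i \notin [set a; b; d] ->
  exists2 z, dual_word C z & word_support z = [set i; a; b; d].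
Proof.
move=> ab ad bd; rewrite !inE !negb_or => /andP[/andP[ia ib] id].
have [ea [Ca eaa eab ead]] := interpolate3 1 0 0 ab ad bd.
have [eb [Cb eba ebb ebd]] := interpolate3 0 1 0 ab ad bd.
have [ed [Cd eda edb edd]] := interpolate3 0 0 1 ab ad bd.
have nza : ea ord0 i != 0.
  apply/eqP=> e0; have : ea = 0 by apply: (agree3 Ca (mem0v _) ib id bd); rewrite !mxE.
  by move/rowP/(_ a)/eqP; rewrite eaa mxE oner_eq0.
have nzb : eb ord0 i != 0.
  apply/eqP=> e0; have : eb = 0 by apply: (agree3 Cb (mem0v _) ia id ad); rewrite !mxE.
  by move/rowP/(_ b)/eqP; rewrite ebb mxE oner_eq0.
have nzd : ed ord0 i != 0.
  apply/eqP=> e0; have : ed = 0 by apply: (agree3 Cd (mem0v _) ia ib ab); rewrite !mxE.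
  by move/rowP/(_ d)/eqP; rewrite edd mxE oner_eq0.
pose z : 'rV[F]_n := (-1) *: delta_mx ord0 i + ea ord0 i *: delta_mx ord0 a
  + eb ord0 i *: delta_mx ord0 b + ed ord0 i *: delta_mx ord0 d.
exists z => [x Cx|].
  have -> : dot z x = - x ord0 i +
      (x ord0 a * ea ord0 i + x ord0 b * eb ord0 i + x ord0 d * ed ord0 i).
    by rewrite dotC /z !dotDr !dot_delta mulrN1 !addrA.
  have xE : x = x ord0 a *: ea + x ord0 b *: eb + x ord0 d *: ed.
    apply: (agree3 Cx _ ab ad bd); rewrite ?memvD ?memvZ // !mxE.
    - by rewrite eaa eba eda; ring.
    - by rewrite eab ebb edb; ring.
    - by rewrite ead ebd edd; ring.
  by rewrite {1}xE !mxE addNr.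
apply/setP=> k; rewrite !inE !mxE !eqxx /=.
have [->|ki] := eqVneq k i.
  by rewrite (negPf ia) (negPf ib) (negPf id) !mulr0 !addr0 mulr1 oppr_eq0 oner_eq0.
have [->|ka] := eqVneq k a.
  by rewrite (negPf ab) (negPf ad) !mulr0 !addr0 add0r mulr1 nza.
have [->|kb] := eqVneq k b; first by rewrite (negPf bd) !mulr0 !addr0 !add0r mulr1 nzb.
have [_|kd] := eqVneq k d; first by rewrite !mulr0 !addr0 !add0r mulr1 nzd.
by rewrite !mulr0 !addr0 eqxx.
Qed.

(** Adding to a dual word a multiple of a dual word of weight four which meets
    its support in three positions enlarges the support by one position, unless the
    scalar is one of four values. *)
Lemma dual_word_weight t : (4 < #|F|)%N -> (4 <= t <= n)%N ->
  exists2 u, dual_word C u & #|word_support u| = t.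
Proof.
move=> q_gt4; elim: t => // t IH /andP[]; rewrite leq_eqVlt => /predU1P[[<-] _|].
  have [|T _ cT] := @extend_set 'I_n set0 3; first by rewrite cards0 card_ord; lia.
  have /card_gt2P[a [b [d [[_ _ _] [ab bd da]]]]] : (2 < #|T|)%N by rewrite cT.
  have ad : a != d by rewrite eq_sym.
  have [|i iT] := @other_index n [set a; b; d]; first by rewrite card_triple //; lia.
  have [z dz sz] := dual_word4 ab ad bd iT; exists z => //.
  by rewrite sz -!setUA cardsU1 !setUA iT card_triple.
rewrite ltnS => le4 ltn; have [u du su] : exists2 u, dual_word C u & #|word_support u| = t.
  by apply: IH; rewrite le4 ltnW.
have /card_gt2P[a [b [d [[Wa Wb Wd] [ab bd da]]]]] : (2 < #|word_support u|)%N.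
  by rewrite su; lia.
have ad : a != d by rewrite eq_sym.
have [|i iW] := @other_index n (word_support u); first by rewrite su.
have iT : i \notin [set a; b; d].
  by rewrite !inE !negb_or; apply/andP; split; [apply/andP; split|];
    apply: contraNneq iW => ->.
have [z dz sz] := dual_word4 ab ad bd iT.
have zk k : (z ord0 k != 0) = (k \in [set i; a; b; d]) by rewrite -sz inE.
(* the scalars for which u + lam z would gain no coordinate at i, or lose one *)
pose bad := [set 0; - u ord0 a / z ord0 a; - u ord0 b / z ord0 b; - u ord0 d / z ord0 d].
have [lam lam_ok] : exists lam, lam \notin bad.
  have /card_gt0P[lam] : (0 < #|~: bad|)%N.
    rewrite (cardsCs (~: bad)) setCK subn_gt0; apply: leq_ltn_trans q_gt4.
    by rewrite /bad !cardsU !cards1; lia.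
  by rewrite inE => ?; exists lam.
move: lam_ok; rewrite !inE !negb_or -!andbA => /and4P[lam0 la lb ld].
exists (u + lam *: z) => [c Cc|].
  by rewrite dotC dotDr dotZr ![dot c _]dotC du // dz // mulr0 addr0.
transitivity #|i |: word_support u|; last by rewrite cardsU1 iW su.
congr #|pred_of_set _|.
have nzsum k : z ord0 k != 0 -> lam != - u ord0 k / z ord0 k -> u ord0 k + lam * z ord0 k != 0.
  move=> nz; apply: contra; rewrite addrC addr_eq0 => /eqP <-; by rewrite mulfK.
apply/setP=> k; rewrite !inE !mxE.
have [->|ki] := eqVneq k i.
  have /eqP-> : u ord0 i == 0 by move: iW; rewrite inE negbK.
  by rewrite add0r mulf_neq0 // zk !inE eqxx.
have [->|ka] := eqVneq k a; first by move: Wa; rewrite inE nzsum ?zk ?inE ?eqxx ?orbT // => ->.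
have [->|kb] := eqVneq k b; first by move: Wb; rewrite inE nzsum ?zk ?inE ?eqxx ?orbT // => ->.
have [->|kd] := eqVneq k d; first by move: Wd; rewrite inE nzsum ?zk ?inE ?eqxx ?orbT // => ->.
have /eqP-> : z ord0 k == 0.
  by rewrite -[_ == _]negbK zk !inE (negPf ki) (negPf ka) (negPf kb) (negPf kd).
by rewrite mulr0 addr0.
Qed.

(** * Covering radius of hyperoval codes *)

Section DeepHole.

Variables (v w : 'rV[F]_n).
Hypothesis v_far : forall c, c \in C -> (#|agree v c| <= 3)%N.
Hypothesis w_far : forall i, exists c, [/\ c \in C, c ord0 i = 0 & dot w c != 0].

(** Suppose that [c] agrees with [v] only at [i] and [j], and let [e] be a
    nonzero codeword that vanishes at [i] and [j]. The [q] quotients [(v_l - c_l) / e_l]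
    at the other positions are nonzero, so two of them are equal, to [r] say, and
    [c + r *: e] agrees with [v] four times. *)
Lemma agree_third c i j : c \in C -> i != j ->
  i \in agree v c -> j \in agree v c -> #|agree v c| = 3.
Proof.
move=> Cc ij ic jc; apply/eqP; rewrite eqn_leq v_far //= ltnNge.
apply/negP=> le2; have agE : [set i; j] = agree v c.
  apply/eqP; rewrite eqEcard cards2 ij le2 andbT.
  by apply/subsetP=> k; rewrite in_set2 => /orP[] /eqP->.
have [l0 [il0 jl0]] := third_index i j.
have [e [Ce ei ej el0]] := interpolate3 0 0 1 ij il0 jl0.
have e_nz l : l != i -> l != j -> e ord0 l != 0.
  move=> li lj; apply/eqP=> el; have : e = 0.
    by apply: (agree3 Ce (mem0v _) ij (l := l)); rewrite ?mxE // eq_sym.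
  by move/rowP/(_ l0)/eqP; rewrite el0 mxE oner_eq0.
pose D := [set l | (l != i) && (l != j)].
pose f l := (v ord0 l - c ord0 l) / e ord0 l.
have [l||l [l' [Dl Dl' nll' eqf]]] := pigeonhole (f := f) (D := D) (E := [set~ 0]).
- rewrite !inE => /andP[li lj]; rewrite mulf_neq0 ?invr_eq0 ?e_nz // subr_eq0 -agreeE -agE.
  by rewrite !inE negb_or li lj.
- by rewrite cardsC1 (card_away2 nE) // ltn_predL ltnW.
move: Dl Dl'; rewrite !inE => /andP[li lj] /andP[l'i l'j].
have sub : [set i; j; l; l'] \subset agree v (c + f l *: e).
  apply/subsetP=> k; rewrite in_setU in_set1 !inE !mxE.
  rewrite -orbA => /or3P[/orP[]/eqP->|/eqP->|/eqP->].
  - by rewrite ei mulr0 addr0 -agreeE.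
  - by rewrite ej mulr0 addr0 -agreeE.
  - by rewrite /f divfK ?e_nz // addrC subrK.
  - by rewrite eqf /f divfK ?e_nz // addrC subrK.
have := v_far (memvD Cc (memvZ (f l) Ce)); rewrite leqNgt => /negP[].
apply: leq_trans (subset_leq_card sub).
rewrite setUC cardsU1 card_triple // 1?eq_sym //.
by rewrite !inE !negb_or l'i l'j eq_sym nll'.
Qed.

Lemma vanishing_line c e i j : i != j -> c \in C -> e \in C -> e != 0 ->
  e ord0 i = 0 -> e ord0 j = 0 -> c ord0 i = 0 -> c ord0 j = 0 ->
  exists r, c = r *: e.
Proof.
move=> ij Cc Ce nze ei ej ci cj; have [l [il jl]] := third_index i j.
have el : e ord0 l != 0.
  apply: contraNneq nze => el; apply/eqP.
  by apply: (agree3 Ce (mem0v _) ij il jl); rewrite mxE.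
exists (c ord0 l / e ord0 l); apply: (agree3 Cc _ ij il jl); rewrite ?memvZ // !mxE.
- by rewrite ei mulr0.
- by rewrite ej mulr0.
- by rewrite divfK.
Qed.

(** Evaluation at [i], evaluation at [j] and [dot w] are linearly dependent on
    [C]: the point defined by [w] lies on the secant through points [i] and [j] of the
    hyperoval. *)
Definition dependent_pair i j :=
  [forall c in C, (c ord0 i == 0) && (c ord0 j == 0) ==> (dot w c == 0)].

Lemma dependent_pairP i j : reflect
  (forall c, c \in C -> c ord0 i = 0 -> c ord0 j = 0 -> dot w c = 0) (dependent_pair i j).
Proof.
apply: (iffP forall_inP) => H c Cc.
  by move=> ci cj; have := H c Cc; rewrite ci cj eqxx => /eqP.
by apply/implyP=> /andP[/eqP ci /eqP cj]; rewrite H.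
Qed.

Lemma independent_pairP i j : ~~ dependent_pair i j ->
  exists e, [/\ e \in C, e ord0 i = 0, e ord0 j = 0 & dot w e != 0].
Proof.
rewrite negb_forall_in => /exists_inP[e Ce]; rewrite negb_imply.
by case/andP=> /andP[/eqP ei /eqP ej] nz; exists e.
Qed.

(** A line through a point of a hyperoval meets it in a second point. Let [c] be a
    nonzero codeword that vanishes at [i] and under [dot w], and [e] a codeword that
    vanishes at [i] but not under [dot w]. If [c] had no further zero, two of the [q + 1]
    quotients [e_l / c_l] would be equal, to [r] say, and [e - r *: c], which is nonzero,
    would vanish three times. *)
Lemma dependent_pair_exists i : exists2 j, j != i & dependent_pair i j.
Proof.
have [|j] := @other_index n [set i]; first by rewrite cards1; lia.
rewrite inE => ji; have ij : i != j by rewrite eq_sym.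
have [dij|/independent_pairP[e [Ce ei ej nze]]] := boolP (dependent_pair i j).
  by exists j.
have [l0 [il0 jl0]] := third_index i j.
have [c2 [Cc2 c2i c2j _]] := interpolate3 0 1 0 ij il0 jl0.
pose c := c2 - (dot w c2 / dot w e) *: e.
have Cc : c \in C by rewrite memvB ?memvZ.
have ci : c ord0 i = 0 by rewrite !mxE c2i ei mulr0 subrr.
have cj : c ord0 j = 1 by rewrite !mxE c2j ej mulr0 subr0.
have wc : dot w c = 0 by rewrite dotDr dotNr dotZr divfK // subrr.
have nzc : c != 0 by apply/eqP=> c0; move/eqP: cj; rewrite c0 mxE eq_sym oner_eq0.
clearbody c.
have [/existsP[l /andP[li /eqP cl]]|] := boolP [exists l, (l != i) && (c ord0 l == 0)].
  exists l => //; apply/dependent_pairP=> x Cx xi xl.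
  have il : i != l by rewrite eq_sym.
  by have [r ->] := vanishing_line il Cx Cc nzc ci cl xi xl; rewrite dotZr wc mulr0.
rewrite negb_exists => /forallP nocl.
have c_nz l : l != i -> c ord0 l != 0 by move=> li; have := nocl l; rewrite li.
pose f l := e ord0 l / c ord0 l.
have [//||l [l' [Dl Dl' nll' eqf]]] := pigeonhole (f := f) (D := [set~ i]) (E := setT).
  by rewrite cardsC1 card_ord cardsT nE addn2.
move: Dl Dl'; rewrite !inE => li l'i.
have : e = f l *: c.
  apply: (agree3 Ce _ _ _ nll' (i := i)); rewrite ?memvZ // 1?eq_sym // !mxE.
  - by rewrite ei ci mulr0.
  - by rewrite divfK ?c_nz.
  - by rewrite eqf divfK ?c_nz.
by move=> ee; case/eqP: nze; rewrite ee dotZr wc mulr0.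
Qed.

Lemma dependent_pair_unique i j j' :
  j != i -> j' != i -> dependent_pair i j -> dependent_pair i j' -> j = j'.
Proof.
move=> ji j'i /dependent_pairP dj /dependent_pairP dj'; apply/eqP/negPn/negP=> jj'.
have [c [Cc ci /eqP[]]] := w_far i.
have ij : i != j by rewrite eq_sym.
have ij' : i != j' by rewrite eq_sym.
have [e1 [Ce1 e1i e1j e1j']] := interpolate3 0 0 1 ij ij' jj'.
have [e2 [Ce2 e2i e2j e2j']] := interpolate3 0 1 0 ij ij' jj'.
have -> : c = c ord0 j' *: e1 + c ord0 j *: e2.
  apply: (agree3 Cc _ ij ij' jj'); rewrite ?memvD ?memvZ // !mxE.
  - by rewrite ci e1i e2i !mulr0 addr0.
  - by rewrite e1j e2j mulr0 add0r mulr1.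
  - by rewrite e1j' e2j' mulr0 addr0 mulr1.
by rewrite dotDr !dotZr (dj e1) ?(dj' e2) // !mulr0 addr0.
Qed.

Definition pair_words i j : {set 'rV[F]_n} :=
  [set c in C | (i \in agree v c) && (j \in agree v c)].

Lemma card_pair_words i j : i != j -> #|pair_words i j| = #|F|.
Proof.
move=> ij; have [l [il jl]] := third_index i j.
rewrite -cardsT -(card_in_imset (f := fun c : 'rV[F]_n => c ord0 l)).
  apply: eq_card => a; rewrite inE; apply/imsetP.
  have [c [Cc ci cj cl]] := interpolate3 (v ord0 i) (v ord0 j) a ij il jl.
  by exists c; rewrite // inE Cc !agreeE ci cj !eqxx.
move=> c e; rewrite !inE => /and3P[Cc /eqP ci /eqP cj] /and3P[Ce /eqP ei /eqP ej] cel.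
by apply: (agree3 Cc Ce ij il jl) => //; [rewrite -ci | rewrite -cj].
Qed.

Definition slice i j (tau : F) : {set 'rV[F]_n} :=
  [set c in pair_words i j | dot w c == tau].

Lemma pair_wordsB c e i j : c \in pair_words i j -> e \in pair_words i j ->
  [/\ (c - e) \in C, (c - e) ord0 i = 0 & (c - e) ord0 j = 0].
Proof.
rewrite !inE => /and3P[Cc /eqP ci /eqP cj] /and3P[Ce /eqP ei /eqP ej].
by rewrite memvB // !mxE -ci -cj ei ej !subrr.
Qed.

Lemma pair_words_nonempty i j : i != j -> exists c, c \in pair_words i j.
Proof. by move=> ij; apply/card_gt0P; rewrite card_pair_words // ltnW. Qed.

Lemma card_slice_independent i j tau : i != j -> ~~ dependent_pair i j ->
  #|slice i j tau| = 1%N.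
Proof.
move=> ij /independent_pairP[e [Ce ei ej nze]].
have ne0 : e != 0 by apply: contraNneq nze => ->; rewrite dot0r.
have [c0 Lc0] := pair_words_nonempty ij.
have Lshift r : c0 + r *: e \in pair_words i j.
  move: Lc0; rewrite !inE => /and3P[Cc0 ci cj].
  by rewrite memvD ?memvZ // !mxE ei ej mulr0 !addr0 ci cj.
pose c := c0 + ((tau - dot w c0) / dot w e) *: e.
have wc : dot w c = tau by rewrite dotDr dotZr divfK // addrC subrK.
apply/eqP/cards1P; exists c; apply/setP=> x; rewrite in_set1 [LHS]inE.
apply/andP/eqP => [[Lx /eqP wx]|->]; last by rewrite Lshift wc.
have [Cxc xci xcj] := pair_wordsB Lx (Lshift _ : c \in _).
have [r exc] := vanishing_line ij Cxc Ce ne0 ei ej xci xcj.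
have /eqP : dot w (x - c) = 0 by rewrite dotDr dotNr wx wc subrr.
rewrite exc dotZr mulf_eq0 (negPf nze) orbF => /eqP r0.
by apply/eqP; rewrite -subr_eq0 exc r0 scale0r.
Qed.

Lemma card_slice_dependent i j c tau : i != j -> dependent_pair i j ->
  c \in pair_words i j -> #|slice i j tau| = ((dot w c == tau) * #|F|)%N.
Proof.
move=> ij /dependent_pairP dij Lc.
have wconst x : x \in pair_words i j -> dot w x = dot w c.
  move=> Lx; have [Cd di dj] := pair_wordsB Lx Lc.
  by apply/eqP; rewrite -subr_eq0 -dotNr -dotDr dij.
case: eqP => [wc|wc].
  rewrite mul1n -(card_pair_words ij); apply: eq_card => x; rewrite inE.
  by case Lx: (x \in _) => //=; rewrite wconst // wc eqxx.
rewrite mul0n; apply: eq_card0 => x; rewrite inE; apply/negP=> /andP[Lx /eqP wx].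
by case: wc; rewrite -(wconst x).
Qed.

(** As [j] varies, the unique [j] dependent on [i] contributes [q] or [0], and
    each of the [q] others contributes [1]. *)
Lemma sum_slices i : exists t, forall tau,
  (\sum_(j | j != i) #|slice i j tau| = #|F| + (t == tau) * #|F|)%N.
Proof.
have [j ji dij] := dependent_pair_exists i; have ij : i != j by rewrite eq_sym.
have [c Lc] := pair_words_nonempty ij; exists (dot w c) => tau.
rewrite (bigD1 j) //= (card_slice_dependent tau ij dij Lc) addnC; congr (_ + _)%N.
rewrite (eq_bigr (fun=> 1%N)) => [|l /andP[li lj]].
  by rewrite sum1dep_card (card_away2 nE) // eq_sym.
apply: card_slice_independent; first by rewrite eq_sym.
by apply: contra lj => dil; apply/eqP/esym; apply: (dependent_pair_unique ji li).
Qed.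

(** A codeword with [a] agreements is counted [a * a.-1] times, and [a] is [0],
    [1] or [3]. *)
Lemma dvdn3_sum_slices tau : (3 %| \sum_i \sum_(j | j != i) #|slice i j tau|)%N.
Proof.
have -> : (\sum_i \sum_(j | j != i) #|slice i j tau| =
   \sum_(c in C | dot w c == tau) #|agree v c| * #|agree v c|.-1)%N.
  transitivity (\sum_i \sum_(j | j != i)
    \sum_(c in C | dot w c == tau) ((i \in agree v c) && (j \in agree v c)) : nat)%N.
    apply: eq_bigr => i _; apply: eq_bigr => j _.
    rewrite -sum1_card big_mkcond [RHS]big_mkcond; apply: eq_bigr => c _ /=.
    rewrite !inE; case: (c \in C) => //=.
    by case: (dot w c == tau); rewrite ?andbF ?andbT //; case: andb.
  under eq_bigr do rewrite exchange_big /=.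
  rewrite exchange_big /=; apply: eq_bigr => c _.
  rewrite -sum_nat_const [RHS]big_mkcond /=; apply: eq_bigr => i _.
  case: ifP => ic; last by rewrite big1.
  rewrite [in RHS](cardsD1 i) ic add1n /=.
  rewrite -sum1_card big_mkcond [RHS]big_mkcond /=; apply: eq_bigr => j _.
  by rewrite in_setD1; case: (j != i) => //=; case: (j \in _).
apply: dvdn_sum => c /andP[Cc _].
have [le1|] := leqP #|agree v c| 1.
  by case: #|_| le1 => [|[|]].
case/card_gt1P=> i [j [ic jc ij]].
by rewrite (agree_third Cc ij ic jc).
Qed.

(** The sum in [dvdn3_sum_slices] equals [q * (q + 2 + b tau)], where [b tau]
    counts the positions whose dependent pair contributes at [tau]. The [q] numbers
    [b tau] have sum [q + 2 < 2 * q], so one of them is at most [1]; then the sum is not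
    divisible by [3]. *)
Lemma no_deep_hole : (2 < #|F|)%N -> #|F| = 2 %[mod 3] -> False.
Proof.
move=> q_gt2 q_mod.
have [t tE] := fin_all_exists sum_slices.
pose b tau := #|[set i | t i == tau]|.
have sum_b : (\sum_tau b tau = n)%N.
  rewrite -[RHS]card_ord -sum1_card (partition_big t predT) //=.
  by apply: eq_bigr => tau _; rewrite sum1dep_card.
have [tau b_le1] : exists tau, (b tau <= 1)%N.
  apply/existsP; apply: contraT; rewrite negb_exists => /forallP b_gt.
  have : (\sum_(tau : F) 2 <= \sum_tau b tau)%N.
    by apply: leq_sum => tau _; rewrite ltnNge b_gt.
  have -> : (\sum_(tau : F) 2 = #|F| * 2)%N by rewrite sum_nat_const.
  by rewrite sum_b nE; lia.
have := dvdn3_sum_slices tau.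
rewrite (eq_bigr _ (fun i _ => tE i tau)) big_split /= sum_nat_const card_ord -big_distrl /=.
have -> : (\sum_i (t i == tau) = b tau)%N.
  by rewrite /b -sum1dep_card [RHS]big_mkcond /=; apply: eq_bigr => i _; case: eqP.
have [k kE] : exists k, #|F| = (3 * k + 2)%N.
  by exists (#|F| %/ 3)%N; rewrite {1}(divn_eq #|F| 3) q_mod mulnC.
rewrite nE kE; case: (b tau) b_le1 => [|[|//]] _.
  have -> : ((3 * k + 2 + 2) * (3 * k + 2) + 0 * (3 * k + 2) =
      (3 * k * k + 6 * k + 2) * 3 + 2)%N by ring.
  by rewrite dvdn_addr ?dvdn_mull.
have -> : ((3 * k + 2 + 2) * (3 * k + 2) + 1 * (3 * k + 2) =
      (3 * k * k + 7 * k + 3) * 3 + 1)%N by ring.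
by rewrite dvdn_addr ?dvdn_mull.
Qed.

End DeepHole.

(** The sum of two coordinates is such a functional: with a zero prescribed at
    [k], a codeword can still be given one coordinate [1] and the other [0]. *)
Lemma weight2_functional : exists w, forall i,
  exists c, [/\ c \in C, c ord0 i = 0 & dot w c != 0].
Proof.
have /card_gt1P[i [j [_ _ ij]]] : (1 < #|[set: 'I_n]|)%N.
  by rewrite cardsT card_ord nE addn2.
exists (1 *: delta_mx ord0 i + 1 *: delta_mx ord0 j) => k.
have wE c : dot (1 *: delta_mx ord0 i + 1 *: delta_mx ord0 j) c = c ord0 i + c ord0 j.
  by rewrite dotC dotDr !dot_delta !mulr1.
have [l [il jl]] := third_index i j.
have [->|ki] := eqVneq k i.
  have [c [Cc ci cj _]] := interpolate3 0 1 0 ij il jl.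
  by exists c; rewrite wE ci cj add0r oner_eq0.
have [->|kj] := eqVneq k j.
  have [c [Cc ci cj _]] := interpolate3 1 0 0 ij il jl.
  by exists c; rewrite wE ci cj addr0 oner_eq0.
have [c [Cc ck ci cj]] := interpolate3 0 1 0 ki kj ij.
by exists c; rewrite wE ci cj addr0 oner_eq0.
Qed.

Lemma hyperoval_covering_radius :
  (2 < #|F|)%N -> #|F| = 2 %[mod 3] -> (covering_radius C <= n - 4)%N.
Proof.
move=> q_gt2 q_mod; apply: covering_radius_le => v.
have [/exists_inP[c Cc agc]|] := boolP [exists c in C, (4 <= #|agree v c|)%N].
  by exists c => //; rewrite hdistE leq_sub2l.
rewrite negb_exists_in => /forall_inP far; have [w w_far] := weight2_functional.
by case: (@no_deep_hole v w _ w_far q_gt2 q_mod) => c /far; rewrite -ltnNge.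
Qed.

Lemma hyperoval_not_uniformly_packed m : #|F| = (2 ^ m)%N ->
  (4 < #|F|)%N -> #|F| = 2 %[mod 3] -> ~ uniformly_packed C.
Proof.
move=> cardF q_gt4 q_mod.
have m_gt0 : (0 < m)%N by case: m cardF q_gt4 => // ->.
apply: (not_uniformly_packed_dual_words m_gt0 cardF) => t /andP[le_t let_n].
have r_le := hyperoval_covering_radius (ltn_trans _ q_gt4) q_mod.
have t_ge4 : (4 <= t)%N.
  by apply: leq_trans le_t; have := r_le isT; lia.
split; first exact: leq_trans t_ge4.
by apply: dual_word_weight; rewrite ?t_ge4.
Qed.

End Hyperoval.

(** * MDS codes of length q + 2 *)

Lemma exp2_odd_mod3 m : odd m -> 2 ^ m = 2 %[mod 3].
Proof.
move=> modd; rewrite -(odd_double_half m) modd -mul2n expnD expnM.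
by rewrite -modnMmr -modnXm exp1n.
Qed.

Theorem theorem16 (F : finFieldType) (m k d : nat)
    (C : {vspace 'rV[F]_(2 ^ m + 2)})
    (hm : 1 < m) (hF : #|F| = 2 ^ m)
    (hC : linear_code C k d) (hmds : mds C) :
  (k = 3 -> d = 2 ^ m -> odd m ->
     ~ uniformly_packed C /\ ~ completely_regular C) /\
  (k = 2 ^ m - 1 -> d = 4 -> completely_regular C).
Proof.
case: hC => _ dimC _; have nE : 2 ^ m + 2 = #|F| + 2 by rewrite hF.
split=> [k3 _ modd|kE _]; last first.
  apply: (dual_hyperoval_completely_regular hmds nE).
  by rewrite dimC kE; lia.
have nup : ~ uniformly_packed C.
  apply: (hyperoval_not_uniformly_packed hmds nE _ hF); first by rewrite dimC.
    rewrite hF -[4]/(2 ^ 2) ltn_exp2l //.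
    by case: m hm modd {C hF hmds dimC nE} => [|[|[|]]].
  by rewrite hF exp2_odd_mod3.
by split=> // /completely_regular_uniformly_packed.
Qed.
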